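(* Let $\varphi\colon\mathbb{R}^n\to\overline{\mathbb{R}}$ be a lower semicontinuous function, and fix $\bar x\in\mathbb{R}^n$ such that $|\varphi(\bar x)|<\infty$. Then the following assertions hold. (a) Pick $u\in\mathcal{C}_\varphi(\bar x)\cap\mathbb{S}$. If $\bar x$ is a local minimizer of $\varphi$ in direction $u$, then $0\in\partial_{\mathrm{g}}\varphi(\bar x;(u,\mathrm{d}\varphi(\bar x)(u)))$. (b) If $\bar x$ is a local minimizer of $\varphi$, then $0\in\partial\varphi(\bar x)$, and $0\in\partial_{\mathrm{g}}\varphi(\bar x;(u,\mathrm{d}\varphi(\bar x)(u)))$ is valid for each $u\in\mathcal{C}_\varphi(\bar x)\cap\mathbb{S}$.
   Context: $\overline{\mathbb{R}}:=\mathbb{R}\cup\{-\infty,\infty\}$; $\mathbb{R}^n$ carries the Euclidean norm $\|\cdot\|$ and inner product $\langle\cdot,\cdot\rangle$; $\mathbb{S}:=\{u\in\mathbb{R}^n : \|u\|=1\}$. Directional neighborhoods: for $\varepsilon,\rho>0$ and $u\in\mathbb{R}^n$, $\mathbb{B}_{\varepsilon,\rho}(u):=\{w\in\mathbb{R}^n : \|w\|\le\varepsilon,\ \big\|\|w\|u-\|u\|w\big\|\le\rho\|u\|\|w\|\}$. Directional local minimality: $\bar x$ (with $|\varphi(\bar x)|<\infty$) is a local minimizer of $\varphi$ in direction $u$ if there are $\varepsilon,\rho>0$ with $\varphi(x)\ge\varphi(\bar x)$ for all $x\in\bar x+\mathbb{B}_{\varepsilon,\rho}(u)$. A local minimizer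 is meant in the usual sense (equivalently, $u=0$). First subderivative: $\mathrm{d}\varphi(\bar x)(u):=\liminf_{t\downarrow0,\,u'\to u}\frac{\varphi(\bar x+tu')-\varphi(\bar x)}{t}$. Critical cone: $\mathcal{C}_\varphi(\bar x):=\{u\in\mathbb{R}^n : \mathrm{d}\varphi(\bar x)(u)\le0\}$. Regular normal cone: for a closed set $\Omega$ in a Euclidean space and $x\in\Omega$, $\widehat N_\Omega(x)$ is the set of all $x^*$ for which there is a function $o\colon[0,\infty)\to\mathbb{R}$ with $o(t)/t\to0$ as $t\downarrow0$ and $\langle x^*,y-x\rangle\le o(\|y-x\|)$ for all $y\in\Omega$. Directional limiting normal cone: for closed $\Omega$, $x\in\Omega$ and a direction $v$, $N_\Omega(x;v)$ is the set of all $x^*$ for which there exist $t_k\downarrow0$, $v_k\to v$, $x_k^*\to x^*$ with $x+t_kv_k\in\Omega$ and $x_k^*\in\widehat N_\Omega(x+t_kv_k)$ for all $k\in\mathbb{N}$. Geometric directional limiting subdifferential: with $\operatorname{epi}\varphi:=\{(x,\alpha)\in\mathbb{R}^n\times\mathbb{R} : \varphi(x)\le\alpha\}$, for $u\in\mathbb{R}^n$ and $\nu\in\mathbb{R}$, $\partial_{\mathrm{g}}\varphi(\bar x;(u,\nu)):=\{x^*\in\mathbb{R}^n : (x^*,-1)\in N_{\operatorname{epi}\varphi}((\bar x,\varphi(\bar x));(u,\nu))\}$. Regular subdifferential at a point $x$ with $|\varphi(x)|<\infty$: $\widehat\partial\varphi(x)$ is the set of $x^*\in\mathbb{R}^n$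 with $\varphi(y)\ge\varphi(x)+\langle x^*,y-x\rangle-o(\|y-x\|)$ as $y\to x$, i.e. $\liminf_{y\to x,\,y\ne x}\frac{\varphi(y)-\varphi(x)-\langle x^*,y-x\rangle}{\|y-x\|}\ge0$. Limiting subdifferential: $\partial\varphi(\bar x)$ is the set of all $x^*$ for which there exist $x_k\to\bar x$ and $x_k^*\to x^*$ with $\varphi(x_k)\to\varphi(\bar x)$, $\varphi(x_k)$ finite, and $x_k^*\in\widehat\partial\varphi(x_k)$ for all $k\in\mathbb{N}$. *)

(* Defs.v *)
From HB Require Import structures.
From mathcomp Require Import all_boot all_order all_algebra.
From mathcomp Require Import all_classical all_reals all_analysis.

Set Implicit Arguments.
Unset Strict Implicit.
Unset Printing Implicit Defensive.

Import Order.TTheory GRing.Theory Num.Theory.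
Import numFieldNormedType.Exports.

Local Open Scope classical_set_scope.
Local Open Scope ring_scope.

(* The library norm `|x| on 'rV[R]_m is the sup norm, hence the explicit
   Euclidean norm.  Both induce the library topology of 'rV[R]_m, which is the
   one used below for limits, neighborhoods and semicontinuity. *)
Definition dotv (R : realType) (m : nat) (x y : 'rV[R]_m) : R :=
  \sum_(i < m) x 0 i * y 0 i.

Definition enorm (R : realType) (m : nat) (x : 'rV[R]_m) : R :=
  Num.sqrt (dotv x x).

Definition esphere (R : realType) (m : nat) : set 'rV[R]_m :=
  [set u | enorm u = 1].

Definition dir_ball (R : realType) (m : nat) (eps rho : R) (u : 'rV[R]_m)
    : set 'rV[R]_m :=
  [set w | enorm w <= eps /\
           enorm (enorm w *: u - enorm u *: w) <= rho * enorm u * enorm w].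

Definition local_minimizer_dir (R : realType) (n : nat)
    (phi : 'rV[R]_n -> \bar R) (xbar u : 'rV[R]_n) : Prop :=
  exists eps rho : R, [/\ 0 < eps, 0 < rho &
    forall w, dir_ball eps rho u w -> (phi xbar <= phi (xbar + w)%R)%E].

Definition local_minimizer (R : realType) (n : nat)
    (phi : 'rV[R]_n -> \bar R) (xbar : 'rV[R]_n) : Prop :=
  \forall x \near xbar, (phi xbar <= phi x)%E.

(* Meaningful when phi xbar is finite; phi itself may take infinite values. *)
Definition subderivative (R : realType) (n : nat)
    (phi : 'rV[R]_n -> \bar R) (xbar u : 'rV[R]_n) : \bar R :=
  limf_einf
    (fun p : R * 'rV[R]_n =>
       ((phi (xbar + p.1 *: p.2)%R - phi xbar) * (p.1^-1)%R%:E)%E)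
    (filter_prod (0 : R)^'+ (nbhs u)).

Definition critical_cone (R : realType) (n : nat)
    (phi : 'rV[R]_n -> \bar R) (xbar : 'rV[R]_n) : set 'rV[R]_n :=
  [set u | (subderivative phi xbar u <= 0)%E].

(* Intended for x in Omega. *)
Definition regular_normal_cone (R : realType) (m : nat)
    (Omega : set 'rV[R]_m) (x : 'rV[R]_m) : set 'rV[R]_m :=
  [set xs | exists o : R -> R,
    ((fun t => o t / t) @ (0 : R)^'+ --> (0 : R)) /\
    (forall y, Omega y -> dotv xs (y - x) <= o (enorm (y - x)))].

Definition dir_limiting_normal_cone (R : realType) (m : nat)
    (Omega : set 'rV[R]_m) (x v : 'rV[R]_m) : set 'rV[R]_m :=
  [set xs | exists (t : nat -> R) (vk xk : nat -> 'rV[R]_m),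
    [/\ (forall k, 0 < t k) /\ (t @ \oo --> (0 : R)),
        vk @ \oo --> v,
        xk @ \oo --> xs &
        forall k, Omega (x + t k *: vk k) /\
                  regular_normal_cone Omega (x + t k *: vk k) (xk k)]].

(* R^n x R is identified with R^(n+1); the Euclidean inner product of the
   latter is the one of the product. *)
Definition pairv (R : realType) (n : nat) (x : 'rV[R]_n) (a : R)
    : 'rV[R]_(n + 1) := row_mx x (const_mx a).

Definition epigraph (R : realType) (n : nat) (phi : 'rV[R]_n -> \bar R)
    : set 'rV[R]_(n + 1) :=
  [set z | exists (x : 'rV[R]_n) (a : R), z = pairv x a /\ (phi x <= a%:E)%E].

(* Meaningful when phi xbar is finite, so that fine (phi xbar) is its value. *)
Definition geo_dir_subdiff (R : realType) (n : nat)
    (phi : 'rV[R]_n -> \bar R) (xbar u : 'rV[R]_n) (nu : R) : set 'rV[R]_n :=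
  [set xs | dir_limiting_normal_cone (epigraph phi)
              (pairv xbar (fine (phi xbar))) (pairv u nu) (pairv xs (-1))].

(* Meaningful when phi x is finite. *)
Definition regular_subdiff (R : realType) (n : nat)
    (phi : 'rV[R]_n -> \bar R) (x : 'rV[R]_n) : set 'rV[R]_n :=
  [set xs | (0 <= limf_einf
    (fun y : 'rV[R]_n =>
       (phi y - phi x - (dotv xs (y - x))%R%:E) * ((enorm (y - x))^-1)%R%:E)
    x^')%E].

Definition limiting_subdiff (R : realType) (n : nat)
    (phi : 'rV[R]_n -> \bar R) (xbar : 'rV[R]_n) : set 'rV[R]_n :=
  [set xs | exists xk xsk : nat -> 'rV[R]_n,
    [/\ xk @ \oo --> xbar,
        xsk @ \oo --> xs,
        (fun k => phi (xk k)) @ \oo --> phi xbar &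
        forall k, phi (xk k) \is a fin_num /\
                  regular_subdiff phi (xk k) (xsk k)]].

(* Main.v *)
Require Import Defs.
From HB Require Import structures.
From mathcomp Require Import all_boot all_order all_algebra.
From mathcomp Require Import all_classical all_reals all_analysis.
From mathcomp Require Import finmap ring lra.

Set Implicit Arguments.
Unset Strict Implicit.
Unset Printing Implicit Defensive.

Import Order.TTheory GRing.Theory Num.Theory.
Import numFieldNormedType.Exports.

Local Open Scope classical_set_scope.
Local Open Scope ring_scope.

(** If xbar minimizes phi in the unit direction u, the quotients
    (phi (xbar + t v) - phi xbar) / t are nonnegative for small t > 0 and v
    near u, because such points xbar + t v lie in a directional neighborhood
    ([local_minimizer_dir_conic]).  Hence the subderivative at u is
    nonnegative, and it is 0 when u is critical.

    By criticality, for every small s > 0 some t in ]0, s[ and some p within s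
    of u make this quotient at most s ^ 2 ([critical_descent]).  For this
    fixed t, let v minimize phi (xbar + t v) + t |v - p| ^ 2 over a box around
    u on which phi (xbar + t v) stays above phi xbar
    ([compact_lsc_min], [proximal_point]).  Comparing with the value at p gives
    |v - p| <= s, so v is an interior point of the box, v is within 2 s of u,
    and the quotient at v lies in [0, s ^ 2].  Expanding the square around v
    turns minimality into a quadratic minorant of phi near y = xbar + t v with
    slope -2 (v - p), of norm at most 2 s.  Such a minorant makes
    (-2 (v - p), -1) a regular normal to the epigraph at (y, phi y)
    ([proximal_regular_normal]).  Letting s tend to 0 gives points that
    approach (xbar, phi xbar) in direction (u, 0), with normals tending to
    (0, -1).

    The scaling of the penalty by t is what makes the argument work: measured
    in v, both the displacement and the slope are then controlled by s alone,
    uniformly in t.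

    For an unrestricted local minimizer, 0 is already a regular subgradient at
    xbar, and xbar is a minimizer in every direction. *)

(** * Lower semicontinuous functions *)

Section LowerSemicontinuity.
Variable R : realType.

Lemma lower_semicontinuous_comp (X Y : topologicalType) (f : Y -> \bar R)
    (h : X -> Y) :
  lower_semicontinuous f -> continuous h -> lower_semicontinuous (f \o h).
Proof.
move=> flsc hc x a /flsc [V Vx Vf].
by exists (h @^-1` V); [exact: hc | move=> y /Vf].
Qed.

Lemma lower_semicontinuousD_continuous (X : topologicalType) (f : X -> \bar R)
    (g : X -> R) :
  lower_semicontinuous f -> continuous g ->
  lower_semicontinuous (fun x => (f x + (g x)%:E)%E).
Proof.
move=> flsc gc x a afx.
have [b ab bf] : exists2 b : R, a - g x < b & (b%:E < f x)%E.
  case fx : (f x) afx => [c| |] //= afx.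
  - exists ((a - g x + c) / 2); last rewrite lte_fin;
    by move: afx; rewrite lte_fin; lra.
  - by exists (a - g x + 1); [lra | rewrite ltry].
have [V Vx Vf] := flsc _ _ bf.
exists (V `&` [set y | a - b < g y]).
  apply: filterI => //; apply: (cvgr_gt (g x)); first exact: gc.
  by move: ab; lra.
move=> y [/Vf bfy /= aby].
have -> : a%:E = ((a - g y)%:E + (g y)%:E)%E by rewrite -EFinD subrK.
rewrite lteD2rE //; apply: lt_trans bfy; rewrite lte_fin; lra.
Qed.

(** If no point of K were a minimizer, the open sets [set x | a%:E < f x],
    with a real number a at least as large as some value of f on K, would cover
    K.  In a finite subcover the least level a is not exceeded at the point
    that witnesses it.  The levels are real because the definition of lower
    semicontinuity only tests real ones. *)
Lemma compact_lsc_min (X : ptopologicalType) (f : X -> \bar R) (K : set X) :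
  compact K -> K !=set0 -> lower_semicontinuous f ->
  exists2 x, K x & forall y, K y -> (f x <= f y)%E.
Proof.
move=> Kc [x0 Kx0] flsc; apply: contrapT => nomin.
have lower x : K x -> exists2 y, K y & (f y < f x)%E.
  move=> Kx; apply: contrapT => nlow; apply: nomin; exists x => // y Ky.
  by rewrite leNgt; apply/negP => lt_yx; apply: nlow; exists y.
(* Descending twice rules out f y = -oo, so f y itself is a real level. *)
have fin_lower x : K x -> exists2 a : R,
    (exists2 y, K y & (f y <= a%:E)%E) & (a%:E < f x)%E.
  move=> /lower [y Ky yx]; have [z Kz zy] := lower y Ky.
  case fy : (f y) yx zy => [a| |] yx zy.
  - by exists a => //; exists y => //; rewrite fy.
  - by move: yx; rewrite ltNge leey.
  - by move: zy; rewrite ltNge leNye.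
pose D := [set a : R | exists2 y, K y & (f y <= a%:E)%E].
move: Kc; rewrite compact_cover.
move=> /(_ R D (fun a => [set x | (a%:E < f x)%E])).
case.
- by move=> a _; move/lower_semicontinuousP: flsc; apply.
- by move=> x /fin_lower [a Da ax]; exists a.
move=> S SD Kcov.
have [a0 /= a0S _] := Kcov _ Kx0.
have Sne : exists a, a \in S by exists a0.
pose m := [arg min_(b < [` a0S]%fset) (fsval b)]%O.
have mS : fsval m \in S := fsvalP m.
have mmin a : a \in S -> fsval m <= a.
  move=> aS; rewrite /m; case: arg_minP => //= i _ /(_ [` aS]%fset isT) /=.
  done.
have /set_mem [y Ky ym] := SD _ mS.
have [a /= aS ay] := Kcov _ Ky.
have := lt_le_trans ay ym; rewrite lte_fin => am.
by have := mmin _ aS; rewrite leNgt am.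
Qed.

End LowerSemicontinuity.

(** * The Euclidean norm and the sup-norm topology *)

Section Euclidean.
Variables (R : realType) (n : nat).
Implicit Types x y z : 'rV[R]_n.

Lemma dotvv_ge0 x : 0 <= dotv x x.
Proof. by apply: sumr_ge0 => i _; rewrite -expr2 sqr_ge0. Qed.

Lemma enorm_ge0 x : 0 <= enorm x.
Proof. exact: sqrtr_ge0. Qed.

Lemma sqr_enorm x : enorm x ^+ 2 = dotv x x.
Proof. by rewrite sqr_sqrtr // dotvv_ge0. Qed.

Lemma dotvZZ (a : R) x y : dotv (a *: x) (a *: y) = a ^+ 2 * dotv x y.
Proof.
by rewrite /dotv mulr_sumr; apply: eq_bigr => i _; rewrite !mxE; ring.
Qed.

Lemma dotvZl (a : R) x y : dotv (a *: x) y = a * dotv x y.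
Proof.
by rewrite /dotv mulr_sumr; apply: eq_bigr => i _; rewrite !mxE; ring.
Qed.

Lemma dotvZr (a : R) x y : dotv x (a *: y) = a * dotv x y.
Proof.
by rewrite /dotv mulr_sumr; apply: eq_bigr => i _; rewrite !mxE; ring.
Qed.

Lemma enormZ (a : R) x : enorm (a *: x) = `|a| * enorm x.
Proof. by rewrite /enorm dotvZZ sqrtrM ?sqr_ge0 // sqrtr_sqr. Qed.

Lemma coord_le_enorm x i : `|x 0 i| <= enorm x.
Proof.
rewrite -sqrtr_sqr ler_wsqrtr // /dotv (bigD1 i) //= -expr2 lerDl.
by apply: sumr_ge0 => j _; rewrite -expr2 sqr_ge0.
Qed.

(** A bound linear in the norm of y is all that is used to control far points
    in [proximal_regular_normal], so this cruder constant replaces the norm of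
    x of the Cauchy-Schwarz inequality. *)
Lemma dotv_le_l1 x y : dotv x y <= (\sum_i `|x 0 i|) * enorm y.
Proof.
rewrite mulr_suml; apply: ler_sum => i _.
by rewrite (le_trans (ler_norm _)) // normrM ler_wpM2l // coord_le_enorm.
Qed.

Lemma dotv_recenter x y z :
  dotv (x - z) (x - z) =
  dotv (y - z) (y - z) + 2 * dotv (y - z) (x - y) + dotv (x - y) (x - y).
Proof.
rewrite /dotv mulr_sumr -!big_split /=; apply: eq_bigr => i _.
by rewrite !mxE; ring.
Qed.

Lemma continuous_dotv (X : topologicalType) (f g : X -> 'rV[R]_n) :
  continuous f -> continuous g -> continuous (fun a => dotv (f a) (g a)).
Proof.
move=> fc gc; apply: continuous_big => [|i _ a]; first exact: add_continuous.
apply: cvgM.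
  apply: (cvg_comp f (fun M : 'rV[R]_n => M 0 i)); first exact: fc.
  exact: coord_continuous.
apply: (cvg_comp g (fun M : 'rV[R]_n => M 0 i)); first exact: gc.
exact: coord_continuous.
Qed.

Lemma continuous_enorm (X : topologicalType) (f : X -> 'rV[R]_n) :
  continuous f -> continuous (fun a => enorm (f a)).
Proof.
move=> fc a.
apply: (cvg_comp (fun a => dotv (f a) (f a)) (@Num.sqrt R)).
  exact: continuous_dotv.
exact: sqrt_continuous.
Qed.

Lemma ball_rVP x (e : R) y :
  ball x e y <-> 0 < e /\ forall i, `|y 0 i - x 0 i| < e.
Proof.
split=> [[e0 xy]|[e0 xy]]; split=> //.
  by move=> i; have := xy 0 i; rewrite -ball_normE /= distrC.
by move=> i j; rewrite -ball_normE /= distrC (ord1 i).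
Qed.

Lemma nbhs_enorm x (P : set 'rV[R]_n) : nbhs x P ->
  exists2 r, 0 < r & forall y, enorm (y - x) < r -> P y.
Proof.
move=> /nbhs_ballP [r /= r0 rP]; exists r => // y yr; apply: rP.
apply/ball_rVP; split=> // i; apply: le_lt_trans yr.
by have := coord_le_enorm (y - x) i; rewrite !mxE.
Qed.

Definition box x (r : R) : set 'rV[R]_n :=
  [set y | forall i, `|y 0 i - x 0 i| <= r].

Lemma compact_box x (r : R) : compact (box x r).
Proof.
have -> : box x r = [set y : 'rV[R]_n | forall i,
    `[x 0 i - r, x 0 i + r]%classic (y 0 i)].
  by apply/seteqP; split=> y yr i; have := yr i; rewrite /= in_itv /= ler_distl.
exact: (@rV_compact _ _ (fun i => `[x 0 i - r, x 0 i + r]%classic)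
  (fun i => @segment_compact _ _ _)).
Qed.

Lemma nbhs_box x (r : R) y : ball x r y -> nbhs y (box x r).
Proof.
move=> xy; have /filterS : nbhs y (ball x r).
  apply: open_nbhs_nbhs; split=> //.
  by apply: ball_open; case/ball_rVP: xy.
by apply=> z /ball_rVP [_ zx] i; rewrite ltW.
Qed.

End Euclidean.

(** * Normals to epigraphs *)

Section Normals.
Variables (R : realType).

Lemma pairvB n (x y : 'rV[R]_n) a b :
  pairv x a - pairv y b = pairv (x - y) (a - b).
Proof.
rewrite /pairv opp_row_mx add_row_mx; congr row_mx.
by apply/matrixP => i j; rewrite !mxE.
Qed.

Lemma dotv_pairv n (x y : 'rV[R]_n) a b :
  dotv (pairv x a) (pairv y b) = dotv x y + a * b.
Proof.
rewrite /dotv big_split_ord /= big_ord1; congr +%R.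
  by apply: eq_bigr => i _; rewrite !row_mxEl.
by rewrite !row_mxEr !mxE.
Qed.

Lemma ball_pairv n (x y : 'rV[R]_n) a b (e : R) :
  ball x e y -> `|b - a| < e -> ball (pairv x a) e (pairv y b).
Proof.
move=> /ball_rVP[e0 xy] ab; apply/ball_rVP; split=> // i.
by case: (split_ordP i) => j ->; rewrite ?row_mxEl ?row_mxEr ?mxE.
Qed.

(** Near (y, a) the minorant bounds the pairing by c times the squared
    distance.  Regular normality asks for a bound over the whole epigraph; at
    distance at least r the linear bound M d is itself at most (M / r) d ^ 2, so
    one quadratic function serves everywhere. *)
Lemma proximal_regular_normal n (phi : 'rV[R]_n -> \bar R) (y xs : 'rV[R]_n)
    (a c : R) :
  0 <= c ->
  (\forall x \near y,
    ((a + dotv xs (x - y) - c * dotv (x - y) (x - y))%:E <= phi x)%E) ->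
  regular_normal_cone (epigraph phi) (pairv y a) (pairv xs (-1)).
Proof.
move=> c0 /nbhs_enorm [r r0 minorant].
pose M := \sum_i `|pairv xs (-1) 0 i|.
have M0 : 0 <= M by exact: sumr_ge0.
exists (fun t => (c + M / r) * t ^+ 2); split.
  rewrite (_ : (fun t => _) = ( *%R (c + M / r))); last first.
    apply/funext => t; have [->|t0] := eqVneq t 0.
      by rewrite invr0 !mulr0.
    by field; rewrite t0 gt_eqF.
  rewrite -[X in _ --> X](mulr0 (c + M / r)).
  by apply: cvg_at_right_filter; exact: mulrl_continuous.
move=> _ [x [b [-> phixb]]]; rewrite pairvB.
set d := enorm _.
have Mr0 : 0 <= M / r by rewrite divr_ge0 // ltW.
have [dr|rd] := ltP d r.
  have xyd : dotv (x - y) (x - y) <= d ^+ 2.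
    by rewrite sqr_enorm dotv_pairv lerDl -expr2 sqr_ge0.
  have xyr : enorm (x - y) < r.
    apply: le_lt_trans dr.
    by rewrite -(@ler_pXn2r _ 2) ?nnegrE ?enorm_ge0 // sqr_enorm.
  have := le_trans (minorant _ xyr) phixb; rewrite lee_fin dotv_pairv.
  have := ler_wpM2l c0 xyd.
  have : 0 <= M / r * d ^+ 2 by rewrite mulr_ge0 ?sqr_ge0.
  lra.
apply: (le_trans (dotv_le_l1 _ _)); rewrite -/M -/d.
rewrite mulrDl -[leLHS]add0r; apply: lerD; first by rewrite mulr_ge0 ?sqr_ge0.
rewrite expr2 mulrA ler_wpM2r ?enorm_ge0 // mulrAC ler_pdivlMr //.
by rewrite ler_wpM2l.
Qed.

(** The sequences of the directional limiting normal cone come from choosing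
    an approximation at each precision 1 / (k + 1). *)
Lemma dir_limiting_normal_cone_approx m (Omega : set 'rV[R]_m)
    (x v xs : 'rV[R]_m) :
  (forall e : R, 0 < e -> exists t (v' xs' : 'rV[R]_m),
    [/\ 0 < t < e, ball v e v', ball xs e xs', Omega (x + t *: v') &
        regular_normal_cone Omega (x + t *: v') xs']) ->
  dir_limiting_normal_cone Omega x v xs.
Proof.
move=> approx.
have /choice [q qP] : forall k : nat, exists q : R * 'rV[R]_m * 'rV[R]_m,
    [/\ 0 < q.1.1 < k.+1%:R^-1, ball v k.+1%:R^-1 q.1.2, ball xs k.+1%:R^-1 q.2,
        Omega (x + q.1.1 *: q.1.2) &
        regular_normal_cone Omega (x + q.1.1 *: q.1.2) q.2].
  move=> k; have [|t [v' [xs' H]]] := approx k.+1%:R^-1.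
    by rewrite invr_gt0.
  by exists (t, v', xs').
exists (fun k => (q k).1.1), (fun k => (q k).1.2), (fun k => (q k).2).
split.
- split; first by move=> k; have [/andP[]] := qP k.
  apply/cvgrPdist_lt => e e0; near=> k.
  have [/andP[t0 tk] _ _ _ _] := qP k.
  rewrite sub0r normrN gtr0_norm //; apply: (lt_trans tk).
  by near: k; exact: near_infty_natSinv_lt (PosNum e0).
- apply/cvg_ballP => e e0; near=> k.
  have [_ vk _ _ _] := qP k; apply: le_ball vk; apply: ltW.
  by near: k; exact: near_infty_natSinv_lt (PosNum e0).
- apply/cvg_ballP => e e0; near=> k.
  have [_ _ xk _ _] := qP k; apply: le_ball xk; apply: ltW.
  by near: k; exact: near_infty_natSinv_lt (PosNum e0).
- by move=> k; have [] := qP k.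
Unshelve. all: by end_near. Qed.

End Normals.

(** * Lower limits along a filter *)

Section LowerLimit.
Variables (R : realType) (T : choiceType) (X : filteredType T).
Variables (f : X -> \bar R) (F : set_system X).

Lemma le_limf_einf (V : set X) (b : \bar R) :
  F V -> (forall q, V q -> (b <= f q)%E) -> (b <= limf_einf f F)%E.
Proof.
move=> FV bf; rewrite limf_einfE.
apply: (@le_trans _ _ (ereal_inf (f @` V))).
  by apply: le_ereal_inf_tmp => _ [q Vq <-]; exact: bf.
by apply: ereal_sup_ubound; exists V.
Qed.

Lemma limf_einf_lt (V : set X) (b : \bar R) :
  (limf_einf f F < b)%E -> F V -> exists2 q, V q & (f q < b)%E.
Proof.
move=> fb FV; have /ereal_inf_lt [_ [q Vq <-] qb] : (ereal_inf (f @` V) < b)%E.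
  apply: le_lt_trans fb; rewrite limf_einfE.
  by apply: ereal_sup_ubound; exists V.
by exists q.
Qed.

End LowerLimit.

(** * Minimizers in a direction *)

Section DirectionalFermat.
Variables (R : realType) (n : nat) (phi : 'rV[R]_n -> \bar R).
Variable xbar : 'rV[R]_n.

(** For u <> 0 this describes a directional neighborhood by a pair (t, v) of a
    step and a direction, the variables of the subderivative. *)
Definition conic_minimizer (u : 'rV[R]_n) (d : R) :=
  forall t v, 0 < t < d -> box u d v -> (phi xbar <= phi (xbar + t *: v)%R)%E.

(** The angular condition defining [dir_ball] is positively homogeneous in w
    and strict at w = u; by continuity it holds for all v near u, hence for all
    t *: v with t > 0. *)
Lemma local_minimizer_dir_conic u :
  enorm u = 1 -> local_minimizer_dir phi xbar u ->
  exists2 d : R, 0 < d & conic_minimizer u d.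
Proof.
move=> u1 [eps [rho [eps0 rho0 minu]]].
have normc : continuous (fun v : 'rV[R]_n => enorm v).
  by apply: (@continuous_enorm _ _ _ id) => v; exact: cvg_id.
have near_lt2 : \forall v \near u, enorm v < 2.
  by apply: (cvgr_lt (enorm u) (normc u)); rewrite u1; lra.
have near_dir : \forall v \near u,
    0 < rho * enorm v - enorm (enorm v *: u - v).
  have gc : continuous (fun v => rho * enorm v - enorm (enorm v *: u - v)).
    have dirc : continuous (fun v => enorm v *: u - v).
      by move=> w; exact: (cvgB (cvgZr_tmp (normc w)) cvg_id).
    move=> w.
    exact: (cvgB (cvgM (cvg_cst rho) (normc w))
      (@continuous_enorm _ _ _ _ dirc w)).
  apply: (cvgr_gt _ (gc u)).
  rewrite u1 scale1r subrr /enorm /dotv big1 ?sqrtr0 => [|i _].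
    by rewrite mulr1 subr0.
  by rewrite mxE mul0r.
have [r /= r0 rP] := (nbhs_ballP _ _).1 (filterI near_lt2 near_dir).
exists (Num.min (r / 2) (eps / 2)).
  by rewrite lt_min; apply/andP; split; lra.
move=> t v /andP[t0]; rewrite lt_min => /andP[_ te] uv.
have [|v2 vrho] := rP v.
  apply/ball_rVP; split=> // i; apply: (le_lt_trans (uv i)).
  by rewrite gt_min; apply/orP; left; lra.
apply: minu; split; rewrite !enormZ (gtr0_norm t0).
  by have := ler_pM (ltW t0) (enorm_ge0 v) (ltW te) (ltW v2); lra.
rewrite u1 scale1r -scalerA -scalerBr enormZ (gtr0_norm t0) mulr1.
by rewrite mulrCA ler_wpM2l ?(ltW t0) //; move: vrho; lra.
Qed.

Lemma local_minimizer_in_direction u :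
  local_minimizer phi xbar -> local_minimizer_dir phi xbar u.
Proof.
move=> /nbhs_enorm [r r0 rP].
exists (r / 2), 1; split=> [||w [wr _]]; [lra | lra |].
by apply: rP; rewrite addrC addKr; lra.
Qed.

Lemma nbhs_conic (u : 'rV[R]_n) (d : R) : 0 < d ->
  filter_prod (0 : R)^'+ (nbhs u) [set q | 0 < q.1 < d /\ box u d q.2].
Proof.
move=> d0; exists ([set t | 0 < t < d], box u d) => //=; split=> /=.
  have near_d := nbhs_right_lt d0.
  have near_0 := nbhs_right_gt (0 : R).
  by apply: filterS2 near_0 near_d => t t0 td; apply/andP.
by apply: nbhs_box; exact: ballxx.
Qed.

Hypothesis phi_fin : phi xbar \is a fin_num.

Lemma conic_minimizer_subderivative_ge0 u d : 0 < d -> conic_minimizer u d ->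
  (0 <= subderivative phi xbar u)%E.
Proof.
move=> d0 mind; apply: le_limf_einf (nbhs_conic u d0) _ => -[t v] [/= td uv].
have /andP[t0 _] := td.
apply: mule_ge0; last by rewrite lee_fin invr_ge0 ltW.
by rewrite sube_ge0 ?phi_fin ?orbT // mind.
Qed.

(** The same s bounds the step, the direction error and, squared, the
    quotient: this is the input that the penalty of [proximal_point] turns into
    a displacement of at most s. *)
Lemma critical_descent u (s : R) : critical_cone phi xbar u -> 0 < s ->
  exists t p, [/\ 0 < t < s, box u s p &
    (phi (xbar + t *: p)%R <= phi xbar + (t * s ^+ 2)%:E)%E].
Proof.
move=> crit s0.
have crit_lt : (subderivative phi xbar u < (s ^+ 2)%:E)%E.
  by apply: le_lt_trans crit _; rewrite lte_fin exprn_gt0.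
have [[t p] [/= ts us] tp] := limf_einf_lt crit_lt (nbhs_conic u s0).
exists t, p; split=> //.
have /andP[t0 _] := ts.
by move: tp; rewrite lte_pdivrMr // -EFinM mulrC lteBlDl // => /ltW.
Qed.

(** The point v minimizes phi (xbar + t v) + t |v - p| ^ 2 over the box.  The
    lower bound on the box makes the value at v finite, and t |v - p| ^ 2 is at
    most the decrease t * s ^ 2 that is available above f0.  The condition
    2 * s < r keeps v off the boundary of the box, so the comparison holds at
    all points near xbar + t v. *)
Lemma proximal_point (f0 t s r : R) u p :
  lower_semicontinuous phi ->
  phi xbar = f0%:E -> 0 < t -> 0 < s -> 2 * s < r ->
  (forall v, box u r v -> (phi xbar <= phi (xbar + t *: v)%R)%E) ->
  box u s p -> (phi (xbar + t *: p)%R <= (f0 + t * s ^+ 2)%:E)%E ->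
  exists v b, [/\ enorm (v - p) <= s, phi (xbar + t *: v) = b%:E,
    f0 <= b <= f0 + t * s ^+ 2 &
    \forall x \near xbar + t *: v,
      ((b + dotv (- 2 *: (v - p)) (x - (xbar + t *: v)) -
        t^-1 * dotv (x - (xbar + t *: v)) (x - (xbar + t *: v)))%:E
        <= phi x)%E].
Proof.
move=> phi_lsc phi0 t0 s0 sr minr up phip.
have affc (c : R) (y : 'rV[R]_n) : continuous (fun v : 'rV[R]_n => y + c *: v).
  by move=> v; exact: (cvgD (cvg_cst y) (cvgZl_tmp cvg_id)).
have psi_lsc : lower_semicontinuous
    (fun v : 'rV[R]_n =>
       (phi (xbar + t *: v)%R + (t * dotv (v - p) (v - p))%:E)%E).
  apply: lower_semicontinuousD_continuous.
    exact: (lower_semicontinuous_comp phi_lsc (affc t xbar)).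
  have subc : continuous (fun v : 'rV[R]_n => v - p).
    by move=> v; exact: (cvgB cvg_id (cvg_cst p)).
  move=> v.
  exact: (cvgM (cvg_cst t) (@continuous_dotv _ _ _ _ _ subc subc v)).
have urp : box u r p by move=> i; apply: (le_trans (up i)); lra.
have [v uv minv] := compact_lsc_min (@compact_box _ _ u r)
  (ex_intro _ p urp) psi_lsc.
have dotpp : dotv (p - p) (p - p) = 0.
  by rewrite subrr /dotv big1 // => i _; rewrite mxE mul0r.
have := minv _ urp; rewrite dotpp mulr0 adde0 => /le_trans /(_ phip) vp.
have phiv := minr _ uv; rewrite phi0 in phiv.
have [b phib] : exists b, phi (xbar + t *: v) = b%:E.
  case E : (phi (xbar + t *: v)) vp phiv => [b| |] //=; first by exists b.
move: vp phiv; rewrite phib -EFinD !lee_fin => vp phiv.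
have q0 := dotvv_ge0 (v - p).
have tq0 : 0 <= t * dotv (v - p) (v - p) by rewrite mulr_ge0 // ltW.
have vps : enorm (v - p) <= s.
  rewrite -(@ler_pXn2r _ 2) ?nnegrE ?enorm_ge0 ?(ltW s0) // sqr_enorm.
  by rewrite -(ler_pM2l t0); lra.
exists v, b; split=> //; first by apply/andP; split; lra.
have nearv : nbhs v (box u r).
  apply: nbhs_box; apply/ball_rVP; split=> [|i]; first lra.
  have := coord_le_enorm (v - p) i; have := up i; rewrite !mxE => h1 h2.
  have -> : v 0 i - u 0 i = (v 0 i - p 0 i) + (p 0 i - u 0 i) by ring.
  by apply: (le_lt_trans (ler_normD _ _)); lra.
(* Points x near xbar + t v are compared through w = (x - xbar) / t. *)
have back x : x = xbar + t *: (- (t^-1 *: xbar) + t^-1 *: x).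
  by rewrite scalerDr scalerN !scalerA divff ?gt_eqF // !scale1r addNKr.
have : \forall x \near xbar + t *: v, box u r (- (t^-1 *: xbar) + t^-1 *: x).
  apply: affc; rewrite scalerDr scalerA mulVf ?gt_eqF // scale1r addKr.
  exact: nearv.
apply: filterS => x /minv; rewrite -back phib.
set w := _ + t^-1 *: x => minw.
have -> : x - (xbar + t *: v) = t *: (w - v).
  by rewrite {1}(back x) -/w scalerBr opprD addrACA subrr add0r.
rewrite -leeBlDr // in minw; apply: le_trans minw.
rewrite -EFinD lee_fin dotvZZ dotvZr dotvZl (dotv_recenter w v p).
have -> : t^-1 * (t ^+ 2 * dotv (w - v) (w - v)) = t * dotv (w - v) (w - v).
  by field; rewrite gt_eqF.
lra.
Qed.

(** The witnesses of [proximal_point] at scale s meet any precision e as soon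
    as s is small against e: the direction is off by at most 2 s, the vertical
    slope by s ^ 2, and the normal by 2 s. *)
Lemma directional_fermat u : lower_semicontinuous phi ->
  enorm u = 1 -> critical_cone phi xbar u -> local_minimizer_dir phi xbar u ->
  exists nu : R, subderivative phi xbar u = nu%:E /\
    geo_dir_subdiff phi xbar u nu 0.
Proof.
move=> phi_lsc u1 crit /(local_minimizer_dir_conic u1) [d d0 mind].
exists 0; split.
  by apply/eqP; rewrite eq_le crit (conic_minimizer_subderivative_ge0 d0 mind).
apply: dir_limiting_normal_cone_approx => e e0.
have phi0 : phi xbar = (fine (phi xbar))%:E by rewrite fineK.
set f0 := fine (phi xbar) in phi0 *.
(* The factor 1 / 4 gives 2 s < e and 2 s < d; s <= 1 gives s ^ 2 <= s. *)
pose s := Num.min e (Num.min d 1) / 4.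
have [se sd s1 s0] : [/\ s <= e / 4, s <= d / 4, s <= 1 / 4 & 0 < s].
  split; rewrite /s.
  - by rewrite ler_pM2r ?invr_gt0 // ge_min lexx.
  - by rewrite ler_pM2r ?invr_gt0 // !ge_min lexx orbT.
  - by rewrite ler_pM2r ?invr_gt0 // !ge_min lexx !orbT.
  - by rewrite divr_gt0 // !lt_min e0 d0 ltr01.
have [t [p [/andP[t0 ts] up phip]]] := critical_descent crit s0.
rewrite phi0 -EFinD in phip.
have sd2 : 2 * s < d by lra.
have mint v : box u d v -> (phi xbar <= phi (xbar + t *: v)%R)%E.
  by apply: mind; rewrite t0; lra.
have [v [b [vps phib /andP[b1 b2] minorant]]] :=
  proximal_point phi_lsc phi0 t0 s0 sd2 mint up phip.
have shift : pairv xbar f0 + t *: pairv v ((b - f0) / t) =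
    pairv (xbar + t *: v) b.
  rewrite /pairv scale_row_mx add_row_mx; congr row_mx.
  by apply/matrixP => i j; rewrite !mxE; field; rewrite gt_eqF.
exists t, (pairv v ((b - f0) / t)), (pairv (- 2 *: (v - p)) (-1)).
rewrite shift; split.
- by rewrite t0; lra.
- apply: ball_pairv.
    apply/ball_rVP; split=> // i.
    have := coord_le_enorm (v - p) i; have := up i; rewrite !mxE => h1 h2.
    have -> : v 0 i - u 0 i = (v 0 i - p 0 i) + (p 0 i - u 0 i) by ring.
    by apply: (le_lt_trans (ler_normD _ _)); lra.
  rewrite subr0 ger0_norm; last by rewrite divr_ge0 ?(ltW t0) // subr_ge0.
  rewrite ltr_pdivrMr //.
  have : s ^+ 2 <= s by rewrite expr2 ger_pMl //; lra.
  move=> ss; have := ler_wpM2l (ltW t0) ss.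
  have : t * s < t * e by rewrite ltr_pM2l //; lra.
  lra.
- apply: ball_pairv; last by rewrite subrr normr0.
  apply/ball_rVP; split=> // i; rewrite !mxE subr0 normrM normrN.
  have := coord_le_enorm (v - p) i; rewrite !mxE => h.
  by rewrite (@ger0_norm _ 2) //; lra.
- by exists (xbar + t *: v), b; rewrite phib.
- by apply: proximal_regular_normal minorant; rewrite invr_ge0 ltW.
Qed.

Lemma fermat_limiting : local_minimizer phi xbar -> limiting_subdiff phi xbar 0.
Proof.
move=> minx; exists (fun=> xbar), (fun=> 0); split; try exact: cvg_cst.
move=> _; split=> //.
apply: (@le_limf_einf _ _ _ _ _ [set y | (phi xbar <= phi y)%E]) => [|y /= miny].
  exact: nbhs_dnbhs.
apply: mule_ge0; last by rewrite lee_fin invr_ge0 enorm_ge0.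
rewrite /dotv big1 ?sube0 ?sube_ge0 ?phi_fin ?orbT // => i _.
by rewrite mxE mul0r.
Qed.

End DirectionalFermat.

(** * The directional Fermat rule *)

Theorem theorem4p1 (R : realType) (n : nat) (phi : 'rV[R]_n -> \bar R)
    (xbar : 'rV[R]_n)
    (phi_lsc : lower_semicontinuous phi)
    (phi_fin : phi xbar \is a fin_num) :
  (forall u : 'rV[R]_n, (critical_cone phi xbar `&` @esphere R n) u ->
     local_minimizer_dir phi xbar u ->
     exists nu : R, subderivative phi xbar u = nu%:E /\
       geo_dir_subdiff phi xbar u nu 0) /\
  (local_minimizer phi xbar ->
     limiting_subdiff phi xbar 0 /\
     forall u : 'rV[R]_n, (critical_cone phi xbar `&` @esphere R n) u ->
       exists nu : R, subderivative phi xbar u = nu%:E /\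
         geo_dir_subdiff phi xbar u nu 0).
Proof.
split=> [u [crit u1]|minx]; first exact: directional_fermat.
split; first exact: fermat_limiting.
move=> u [crit u1]; apply: directional_fermat => //.
exact: local_minimizer_in_direction.
Qed.
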